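(* Let $n>k\ge1$ be odd coprime integers, $A=\Bbbk_{-1}[u,v]$ and $G=G_{n,k}$. Write the Hirzebruch–Jung continued fraction $\frac{2n}{n+k}=[\gamma_1,\dots,\gamma_{d-1}]$ (so $\gamma_1=2$, $d\ge3$), and set $\beta_3=\gamma_3+1$ (if $d\ge4$) and $\beta_i=\gamma_i$ for $i\ne3$. Define $s_1=s_2=1$, $t_1=2\beta_2+1$, $t_2=2\beta_2-1$, and for $3\le i\le d-1$, $s_i=\beta_is_{i-1}-s_{i-2}$, $t_i=\beta_it_{i-1}-t_{i-2}$; put $r_i=\tfrac12(kt_i-ns_i)$ for $1\le i\le d-1$. Then $A^G$ is generated as a $\Bbbk$-algebra by $$x_i=\big(u^{ns_i}+(-1)^{r_i+ns_i}v^{ns_i}\big)(uv)^{r_i}\ (1\le i\le d-1),\qquad x_d=(uv)^{2k}.$$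
   Context: $\Bbbk$ is algebraically closed of characteristic $0$; $\Bbbk_{-1}[u,v]=\Bbbk\langle u,v\rangle/(vu+uv)$; matrices $\begin{pmatrix}a&b\\c&d\end{pmatrix}$ act by $u\mapsto au+cv$, $v\mapsto bu+dv$. $G_{n,k}$ is generated by $\mathrm{diag}(\omega^{2k},\omega^{-2k})$ and $\begin{pmatrix}0&\omega^n\\\omega^n&0\end{pmatrix}$ for $\omega$ a primitive $(2nk)$th root of unity. The Hirzebruch–Jung continued fraction of a rational $x>0$ is the unique expression $x=a_1-\cfrac{1}{a_2-\cfrac{1}{\ddots-\cfrac1{a_m}}}=[a_1,\dots,a_m]$ with integers $a_1\ge1$ and $a_2,\dots,a_m\ge2$. *)

(* Defs.v *)
From HB Require Import structures.
From mathcomp Require Import all_boot all_order all_algebra.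
Set Implicit Arguments. Unset Strict Implicit. Unset Printing Implicit Defensive.
Import Order.TTheory GRing.Theory Num.Theory.
Local Open Scope ring_scope.

(* The skew polynomial ring  k_{-1}[u,v] = k<u,v>/(vu+uv).                *)
(* Underlying k-vector space: {poly {poly K}}, where an element f stands  *)
(* for  sum_{a,b} ((f`_a)`_b) u^a v^b  (outer variable = u, inner = v),   *)
(* the monomials u^a v^b being a k-basis of k_{-1}[u,v].                  *)
(* The multiplication is the skew one:                                    *)
(*     u^a v^b * u^c v^d = (-1)^(b c) u^(a+c) v^(b+d).                     *)

Definition skA (K : fieldType) := {poly {poly K}}.

Definition uA {K : fieldType} : skA K := 'X.
Definition vA {K : fieldType} : skA K := ('X)%:P.
Definition cA {K : fieldType} (c : K) : skA K := c%:P%:P.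
Definition oneA {K : fieldType} : skA K := 1.
Definition addA {K : fieldType} (f g : skA K) : skA K := f + g.

Definition negu {K : fieldType} (g : skA K) : skA K :=
  \poly_(i < size g) ((-1) ^+ i * g`_i).
Definition evenv {K : fieldType} (p : {poly K}) : {poly K} :=
  \poly_(j < size p) (if odd j then 0 else p`_j).

Definition amul {K : fieldType} (f g : skA K) : skA K :=
  map_poly evenv f * g + (f - map_poly evenv f) * negu g.

Definition apow {K : fieldType} (f : skA K) (m : nat) : skA K :=
  iter m (amul f) 1.

Definition i0 : 'I_2 := ord0.
Definition i1 : 'I_2 := ord_max.

Definition act {K : fieldType} (M : 'M[K]_2) (f : skA K) : skA K :=
  let gu := addA (amul (cA (M i0 i0)) uA) (amul (cA (M i1 i0)) vA) in
  let gv := addA (amul (cA (M i0 i1)) uA) (amul (cA (M i1 i1)) vA) in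
  \sum_(i < size f) \sum_(j < size f`_i)
     amul (cA ((f`_i)`_j)) (amul (apow gu i) (apow gv j)).

Definition mx2 {K : fieldType} (a b c d : K) : 'M[K]_2 :=
  \matrix_(i < 2, j < 2)
    if val i == 0%N then (if val j == 0%N then a else b)
    else (if val j == 0%N then c else d).

Inductive inGroup {K : fieldType} (g1 g2 : 'M[K]_2) : 'M[K]_2 -> Prop :=
| inG1 : inGroup g1 g2 g1
| inG2 : inGroup g1 g2 g2
| inG_id : inGroup g1 g2 1%:M
| inG_mul M N : inGroup g1 g2 M -> inGroup g1 g2 N -> inGroup g1 g2 (M *m N)
| inG_inv M : inGroup g1 g2 M -> inGroup g1 g2 (invmx M).

Definition Gnk_gen1 {K : fieldType} (n k : nat) (w : K) : 'M[K]_2 :=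
  mx2 (w ^+ (2 * k)) 0 0 (w ^- (2 * k)).
Definition Gnk_gen2 {K : fieldType} (n k : nat) (w : K) : 'M[K]_2 :=
  mx2 0 (w ^+ n) (w ^+ n) 0.

Definition isInvariant {K : fieldType} (n k : nat) (w : K) (f : skA K) : Prop :=
  forall M, inGroup (Gnk_gen1 n k w) (Gnk_gen2 n k w) M -> act M f = f.

Inductive inSubalg {K : fieldType} (xs : seq (skA K)) : skA K -> Prop :=
| sa_const c : inSubalg xs (cA c)
| sa_gen x : x \in xs -> inSubalg xs x
| sa_add f g : inSubalg xs f -> inSubalg xs g -> inSubalg xs (addA f g)
| sa_mul f g : inSubalg xs f -> inSubalg xs g -> inSubalg xs (amul f g).

Fixpoint hjval (s : seq int) : rat :=
  match s with
  | [::] => 0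
  | [:: a] => a%:~R
  | a :: s' => a%:~R - (hjval s')^-1
  end.

Definition is_HJ (s : seq int) (x : rat) : Prop :=
  [/\ s != [::], 1 <= head 0 s, all (fun a => 2 <= a) (behead s) & hjval s = x].

(* two-term linear recurrence: y_1 = x1, y_2 = x2,
   y_i = b i * y_{i-1} - y_{i-2} for i >= 3 *)
Fixpoint recp (b : nat -> int) (x1 x2 : int) (m : nat) : int * int :=
  match m with
  | 0 => (x1, x2)
  | m'.+1 => let p := recp b x1 x2 m' in (p.2, b m'.+3 * p.2 - p.1)
  end.
Definition rec2 (b : nat -> int) (x1 x2 : int) (i : nat) : int :=
  (recp b x1 x2 i.-1).1.

Definition beta (gamma : seq int) (i : nat) : int :=
  if i == 3%N then gamma`_2 + 1 else gamma`_i.-1.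
Definition sseq (gamma : seq int) (i : nat) : int := rec2 (beta gamma) 1 1 i.
Definition tseq (gamma : seq int) (i : nat) : int :=
  rec2 (beta gamma) (2 * beta gamma 2 + 1) (2 * beta gamma 2 - 1) i.
Definition twice_r (n k : nat) (gamma : seq int) (i : nat) : int :=
  k%:Z * tseq gamma i - n%:Z * sseq gamma i.

Definition uvA {K : fieldType} : skA K := amul uA vA.

(* x_i for 1 <= i <= d-1 (exponents are the nat values of n s_i and r_i) *)
Definition xgen {K : fieldType} (n k : nat) (gamma : seq int) (i : nat) : skA K :=
  let ns := (n * `|sseq gamma i|)%N in
  let r := `|(twice_r n k gamma i %/ 2)%Z|%N in
  amul (addA (apow uA ns) (amul (cA ((-1) ^+ (r + ns))) (apow vA ns))) (apow uvA r).

Definition xlast {K : fieldType} (k : nat) : skA K := apow uvA (2 * k).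

(* Main.v *)
Require Import Defs.
From HB Require Import structures.
From mathcomp Require Import all_boot all_order all_algebra.
From mathcomp Require Import zify ring lra.
Set Implicit Arguments. Unset Strict Implicit. Unset Printing Implicit Defensive.
Import Order.TTheory GRing.Theory Num.Theory.
Local Open Scope ring_scope.

(** Every element of [G] is diagonal or antidiagonal, so invariance of [f] is a
    condition on coefficients: [u^i v^j] occurs only if [n] divides [i - j] and
    [k] divides [i + j], and the coefficients at [(i, j)] and [(j, i)] agree up
    to an explicit sign. Hence the lexicographically leading monomial of an
    invariant has [j <= i], and with [i - j = n s], [i + j = k t] the possible
    [(s, t)] form the cone [n s <= k t] in the lattice [s = t mod 2], except that
    [s = 0] forces [4 %| t]. Leading monomials are multiplicative up to sign, so it
    is enough that the exponent vectors of the [x_i] generate this semigroup: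
    subtracting suitable products then lowers the leading monomial.

    By the Hirzebruch-Jung expansion the cone has the Hilbert basis
    [U_0 = (0, 2)], [U_i = (s_{i+1}, t_{i+1})]. The vector [U_0] itself is not
    the exponent of an invariant, only [2 U_0] (for [x_d]) and [U_0 + U_1] (for
    [x_1]) are, which still reach every admissible point. *)

(** * Coefficients of products and of the linear action *)

Section SkewPlane.
Variable K : fieldType.
Implicit Types (f g h : skA K) (c : K).

Lemma coef_evenv (p : {poly K}) j : (evenv p)`_j = if odd j then 0 else p`_j.
Proof.
by rewrite coef_poly; case: ltnP => // /(nth_default 0) ->; rewrite if_same.
Qed.

Lemma coef_map_evenv f i j :
  (map_poly evenv f)`_i`_j = if odd j then 0 else f`_i`_j.
Proof.
rewrite coef_map_id0 ?coef_evenv //.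
by apply/polyP => l; rewrite coef_evenv !coef0 if_same.
Qed.

Lemma coef_negu g i : (negu g)`_i = (-1) ^+ i * g`_i.
Proof. by rewrite coef_poly; case: ltnP => // /(nth_default 0) ->; rewrite mulr0. Qed.

Lemma coef_sign_mul m (p : {poly K}) j : ((-1) ^+ m * p)`_j = (-1) ^+ m * p`_j.
Proof. by rewrite -signr_odd -[in RHS]signr_odd !mulr_sign; case: ifP => _; rewrite ?coefN. Qed.

(** [amul] splits [f] by the parity of the [v]-exponent: an odd power of [v] passes [u^c] at the
    cost of [(-1)^c], an even one freely. *)
Lemma coef_amul f g i j : (amul f g)`_i`_j =
  \sum_(a < i.+1) \sum_(b < j.+1)
     (-1) ^+ (b * (i - a)) * f`_a`_b * g`_(i - a)`_(j - b).
Proof.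
rewrite /amul !coefD !coefM !coef_sum -big_split; apply: eq_bigr => a _ /=.
rewrite !coefM -big_split; apply: eq_bigr => b _ /=.
rewrite coef_negu coef_sign_mul coefB coefB coef_map_evenv -(signr_odd _ (b * _)) oddM.
case: (odd b) => /=; first by rewrite subr0 signr_odd; ring.
by rewrite subrr; ring.
Qed.

Lemma coef_addA f g i j : (Defs.addA f g)`_i`_j = f`_i`_j + g`_i`_j.
Proof. by rewrite !coefD. Qed.

Lemma amulDl f g h : amul (Defs.addA f g) h = Defs.addA (amul f h) (amul g h).
Proof.
apply/polyP => i; apply/polyP => j; rewrite coef_addA !coef_amul -big_split.
apply: eq_bigr => a _; rewrite -big_split; apply: eq_bigr => b _ /=.
by rewrite coef_addA; ring.
Qed.

Definition mono c (a b : nat) : skA K := (c *: 'X^b)%:P * 'X^a.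

Lemma coef_mono c a b i j : (mono c a b)`_i`_j = c *+ ((i == a) && (j == b)).
Proof.
rewrite coefCM coefXn; case: (i == a); rewrite ?mulr1 ?mulr0 ?coef0 //.
by rewrite coefZ coefXn /= mulr_natr.
Qed.

Lemma amul_mono c a b c' a' b' :
  amul (mono c a b) (mono c' a' b') =
  mono ((-1) ^+ (b * a') * c * c') (a + a') (b + b').
Proof.
apply/polyP => i; apply/polyP => j; rewrite coef_amul coef_mono.
under eq_bigr => x _ do under eq_bigr => y _ do rewrite !coef_mono.
have [/andP[/eqP-> /eqP->]|ne] := boolP (_ && _); last first.
  rewrite big1 // => x _; rewrite big1 // => y _.
  case: (eqVneq (x : nat) a) => [e1|_]; last by rewrite mulr0 mul0r.
  case: (eqVneq (y : nat) b) => [e2|_]; last by rewrite mulr0 mul0r.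
  case: (eqVneq (i - x)%N a') => [e3|_]; last by rewrite mulr0.
  case: (eqVneq (j - y)%N b') => [e4|_]; last by rewrite mulr0.
  by case/negP: ne; move: (ltn_ord x) (ltn_ord y); rewrite !ltnS; lia.
have h1 : (a < (a + a').+1)%N by lia.
have h2 : (b < (b + b').+1)%N by lia.
rewrite (bigD1 (Ordinal h1)) //= [X in _ + X]big1 => [|x]; last first.
  rewrite -val_eqE /= => /negbTE->; rewrite big1 // => y _.
  by rewrite mulr0 mul0r.
rewrite addr0 (bigD1 (Ordinal h2)) //= [X in _ + X]big1 => [|x]; last first.
  by rewrite -val_eqE /= => /negbTE->; rewrite andbF mulr0 mul0r.
by rewrite !addKn !eqxx !addr0.
Qed.

Lemma cA_mono c : cA c = mono c 0 0.
Proof. by rewrite /mono !expr0 mulr1 alg_polyC. Qed.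

Lemma uA_mono : uA = mono 1 1 0.
Proof. by rewrite /mono expr1 !expr0 scale1r mul1r. Qed.

Lemma vA_mono : vA = mono 1 0 1.
Proof. by rewrite /mono expr1 !expr0 scale1r mulr1. Qed.

Lemma mono0 a b : mono 0 a b = 0.
Proof. by rewrite /mono scale0r mul0r. Qed.

Lemma apowS f m : apow f m.+1 = amul f (apow f m).
Proof. by []. Qed.

Lemma apow0 f : apow f 0 = mono 1 0 0.
Proof. by rewrite -cA_mono. Qed.

Lemma apow_u c m : apow (mono c 1 0) m = mono (c ^+ m) m 0.
Proof.
elim: m => [|m IH]; first by rewrite apow0.
by rewrite apowS IH amul_mono mul0n expr0 mul1r exprS.
Qed.

Lemma apow_v c m : apow (mono c 0 1) m = mono (c ^+ m) 0 m.
Proof.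
elim: m => [|m IH]; first by rewrite apow0.
by rewrite apowS IH amul_mono muln0 expr0 mul1r exprS.
Qed.

Lemma apow_uv m : exists e : bool, apow uvA m = mono ((-1) ^+ e) m m.
Proof.
have -> : uvA = mono 1 1 1 by rewrite /uvA uA_mono vA_mono amul_mono muln0 expr0 !mul1r.
elim: m => [|m [e IH]]; first by exists false; rewrite apow0.
exists (odd m (+) e); rewrite apowS IH amul_mono mul1n mulr1 signr_addb.
by rewrite signr_odd.
Qed.

Lemma coef_amul_cA c f i j : (amul (cA c) f)`_i`_j = c * f`_i`_j.
Proof.
rewrite coef_amul big_ord_recl [X in _ + X]big1 => [|a _]; last first.
  by rewrite big1 // => b _; rewrite cA_mono coef_mono mulr0 mul0r.
rewrite addr0 big_ord_recl [X in _ + X]big1 => [|a _]; last first.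
  by rewrite cA_mono coef_mono andbF mulr0 mul0r.
by rewrite cA_mono coef_mono /= !addr0 !subn0 mul0n expr0 mul1r.
Qed.

(** The condition on [F] gives positions outside the support the value 0, so the size bounds
    disappear. *)
Lemma sum_coef f (F : nat -> nat -> K) (i j : nat) :
  (forall a b, f`_a`_b = 0 -> F a b = 0) ->
  \sum_(a < size f) \sum_(b < size f`_a) F a b *+ ((i == a) && (j == b)) = F i j.
Proof.
move=> F0; have [/(nth_default 0) fi|hi] := leqP (size f) i.
  rewrite F0 ?fi ?coef0 // big1 // => a _; rewrite big1 // => b _.
  case: eqVneq => //= e; suff F0' x : F a x = 0 by rewrite F0' mul0rn.
  by rewrite F0 // -e fi coef0.
rewrite (bigD1 (Ordinal hi)) //= [X in _ + X]big1 => [|a]; last first.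
  by rewrite -val_eqE eq_sym /= => /negbTE->; rewrite big1.
rewrite addr0 eqxx; have [/(nth_default 0) fj|hj] := leqP (size f`_i) j.
  rewrite F0 // big1 // => b _; case: eqVneq => //= e; apply: F0.
  by rewrite -e.
rewrite (bigD1 (Ordinal hj)) //= [X in _ + X]big1 => [|a]; last first.
  by rewrite -val_eqE eq_sym /= => /negbTE->.
by rewrite addr0 eqxx.
Qed.

Lemma mx2E (a b c d : K) : (mx2 a b c d i0 i0 = a) * (mx2 a b c d i0 i1 = b)
  * (mx2 a b c d i1 i0 = c) * (mx2 a b c d i1 i1 = d).
Proof. by rewrite !mxE. Qed.

Lemma coef_act_diag a d f i j :
  (act (mx2 a 0 0 d) f)`_i`_j = a ^+ i * d ^+ j * f`_i`_j.
Proof.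
rewrite -(sum_coef (f := f) (F := fun i j => a ^+ i * d ^+ j * f`_i`_j)) =>
  [|x y ->]; last by rewrite mulr0.
rewrite /act !mx2E !coef_sum; apply: eq_bigr => x _.
rewrite !coef_sum; apply: eq_bigr => y _.
rewrite /Defs.addA !cA_mono uA_mono vA_mono !amul_mono !mulr1 !mulr0 !mono0 addr0 add0r.
rewrite !mul1r apow_u apow_v !amul_mono coef_mono !addn0 !add0n.
by rewrite mul0n !mul1r mulrC.
Qed.

(** [u] goes to [c v] and [v] to [b u], so exponents swap, and reordering [v^j u^i] costs
    [(-1)^(ij)]. *)
Lemma coef_act_anti b c f i j :
  (act (mx2 0 b c 0) f)`_i`_j = (-1) ^+ (i * j) * c ^+ j * b ^+ i * f`_j`_i.
Proof.
rewrite -(sum_coef (f := f)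
  (F := fun j i => (-1) ^+ (i * j) * c ^+ j * b ^+ i * f`_j`_i)) =>
  [|x y ->]; last by rewrite mulr0.
rewrite /act !mx2E !coef_sum; apply: eq_bigr => x _.
rewrite !coef_sum; apply: eq_bigr => y _.
rewrite /Defs.addA !cA_mono uA_mono vA_mono !amul_mono !mulr1 !mulr0 !mono0 addr0 add0r.
rewrite !mul1r apow_u apow_v !amul_mono coef_mono !addn0 !add0n andbC mulnC.
by congr (_ *+ _); rewrite muln0 [(x * y)%N]mulnC; ring.
Qed.

(** * Leading monomials *)

Definition lex_below f (i j : nat) := forall a b,
  f`_a`_b != 0 -> (a < i)%N || (a == i) && (b < j)%N.

Definition lead f (i j : nat) := f`_i`_j != 0 /\ lex_below f i j.+1.

(** Only the two leading terms meet at the sum of exponents; up to sign, the coefficient there is a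
    product of two nonzero scalars. *)
Lemma leadM f g i j i' j' :
  lead f i j -> lead g i' j' -> lead (amul f g) (i + i') (j + j').
Proof.
move=> [fij fl] [gij gl]; split; last first.
  move=> A B; apply: contraNT => nlt; apply/eqP.
  rewrite coef_amul big1 // => a _; rewrite big1 // => b _.
  have [->|/fl fab] := eqVneq f`_a`_b 0; first by rewrite mulr0 mul0r.
  have [->|/gl gab] := eqVneq g`_(A - a)`_(B - b) 0; first by rewrite mulr0.
  by case/negP: nlt; move: fab gab (ltn_ord a) (ltn_ord b); lia.
have h1 : (i < (i + i').+1)%N by lia.
have h2 : (j < (j + j').+1)%N by lia.
rewrite coef_amul (bigD1 (Ordinal h1)) //= [X in _ + X]big1 ?addr0 => [|a]; last first.
  rewrite -val_eqE /= => ai; rewrite big1 // => b _.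
  have [->|/fl fab] := eqVneq f`_a`_b 0; first by rewrite mulr0 mul0r.
  have [->|/gl gab] := eqVneq g`_(i + i' - a)`_(j + j' - b) 0; first by rewrite mulr0.
  by move: ai fab gab (ltn_ord a) (ltn_ord b); lia.
rewrite (bigD1 (Ordinal h2)) //= [X in _ + X]big1 ?addr0 => [|b]; last first.
  rewrite -val_eqE /= => bj.
  have [->|/fl fab] := eqVneq f`_i`_b 0; first by rewrite mulr0 mul0r.
  have [->|/gl gab] := eqVneq g`_(i + i' - i)`_(j + j' - b) 0; first by rewrite mulr0.
  by move: bj fab gab (ltn_ord b); lia.
by rewrite !addKn !mulf_neq0 // signr_eq0.
Qed.

End SkewPlane.

(** * Invariance as a condition on coefficients *)

Lemma divf_eq1 (F : fieldType) (x y : F) : y != 0 -> (x / y == 1) = (x == y).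
Proof. by move=> y0; rewrite -(inj_eq (mulIf y0)) divfK // mul1r. Qed.

Section Invariants.
Variables (K : fieldType) (n k : nat) (w : K).
Implicit Types (f g : skA K) (M : 'M[K]_2).

Definition invlat (i j : nat) := (i == j %[mod n]) && (k %| i + j)%N.

Lemma invlatC i j : invlat i j = invlat j i.
Proof. by rewrite /invlat eq_sym addnC. Qed.

(** The antidiagonal generator gives the symmetry, the diagonal one the congruence; [k %| i + j] on
    the support then follows by [invcoef_lat]. *)
Definition invcoef f := forall i j,
  f`_i`_j = (-1) ^+ (i * j) * (w ^+ n) ^+ (i + j) * f`_j`_i /\
  (f`_i`_j != 0 -> i = j %[mod n]).

Lemma invcoef_neq0C f i j : invcoef f -> f`_i`_j != 0 -> f`_j`_i != 0.
Proof. by move=> /(_ i j)[-> _]; rewrite mulf_eq0 negb_or => /andP[]. Qed.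

Lemma invcoefM f g : invcoef f -> invcoef g -> invcoef (amul f g).
Proof.
move=> fI gI i j; split.
  rewrite !coef_amul exchange_big mulr_sumr /=; apply: eq_bigr => b _.
  rewrite mulr_sumr; apply: eq_bigr => a _.
  have [-> _] := fI a b; have [-> _] := gI (i - a)%N (j - b)%N.
  have ai : (a <= i)%N by rewrite -ltnS.
  have bj : (b <= j)%N by rewrite -ltnS.
  have -> : (w ^+ n) ^+ (i + j) = (w ^+ n) ^+ (a + b) * (w ^+ n) ^+ (i - a + (j - b)).
    by rewrite -exprD; congr (_ ^+ _); lia.
  (* Expansion of [(a + (i - a))(b + (j - b))]; the cross term [a(j - b)] cancels against the
     commutation sign of the swapped product. *)
  have -> : (-1) ^+ (i * j) = (-1) ^+ (a * b) * (-1) ^+ (a * (j - b)) *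
     ((-1) ^+ (b * (i - a)) * (-1) ^+ ((i - a) * (j - b))) :> K.
    by rewrite -!exprD; congr (_ ^+ _); nia.
  have := sqrr_sign K (a * (j - b)); rewrite expr2.
  set s := (-1) ^+ (a * (j - b)) => ss.
  by rewrite -[LHS]mul1r -ss; ring.
move=> nz; apply/eqP; apply: contraNT nz => ij; apply/eqP.
rewrite coef_amul big1 // => a _; rewrite big1 // => b _.
have [->|fab] := eqVneq f`_a`_b 0; first by rewrite mulr0 mul0r.
have [->|gab] := eqVneq g`_(i - a)`_(j - b) 0; first by rewrite mulr0.
have ai : (a <= i)%N by rewrite -ltnS.
have bj : (b <= j)%N by rewrite -ltnS.
case/eqP: ij; rewrite -(subnKC ai) -(subnKC bj) -modnDm.
by rewrite ((fI a b).2 fab) ((gI _ _).2 gab) modnDm.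
Qed.

Lemma invcoef_cA c : invcoef (cA c).
Proof.
move=> i j; rewrite cA_mono !coef_mono.
case: (eqVneq i 0%N) => [->|]; case: (eqVneq j 0%N) => [->|] //=;
  by rewrite ?mulr0 ?eqxx // !expr0 !mul1r.
Qed.

Lemma invcoef_addZ c f g : invcoef f -> invcoef g -> invcoef (Defs.addA f (amul (cA c) g)).
Proof.
move=> fI /(invcoefM (invcoef_cA c)); move: (amul _ g) => h hI i j.
rewrite !coef_addA; split.
  by rewrite {1}(fI i j).1 {1}(hI i j).1 mulrDr.
have [fij|/(fI i j).2//] := eqVneq f`_i`_j 0.
by rewrite fij add0r; apply: (hI i j).2.
Qed.

Variable xs : seq (skA K).

(** [p] is kept invariant so that subtracting a multiple of it from an invariant leaves an
    invariant. *)
Definition lead_reached i j :=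
  exists p, [/\ inSubalg xs p, invcoef p & lead p i j].

Lemma lead_reachedD i j i' j' : lead_reached i j -> lead_reached i' j' ->
  lead_reached (i + i') (j + j').
Proof.
move=> [p [sp Ip lp]] [q [sq Iq lq]]; exists (amul p q).
by split; [apply: sa_mul | apply: invcoefM | apply: leadM].
Qed.

Lemma lead_reached0 : lead_reached 0 0.
Proof.
exists (cA 1); split; [exact: sa_const | exact: invcoef_cA | split].
  by rewrite cA_mono coef_mono oner_neq0.
move=> a b; rewrite cA_mono coef_mono ltn0.
by case: (a == 0%N); case: (eqVneq b 0%N) => [->|_]; rewrite ?eqxx.
Qed.

Hypotheses (n_gt0 : (0 < n)%N) (k_gt0 : (0 < k)%N).
Hypothesis hw : (2 * n * k).-primitive_root w.

Lemma w_neq0 : w != 0.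
Proof.
apply/eqP => w0; have := prim_expr_order hw; rewrite w0 expr0n.
by rewrite !muln_eq0 !eqn0Ngt n_gt0 k_gt0 /= => /eqP; rewrite eq_sym oner_eq0.
Qed.

Lemma expw_eq1 m : ((w ^+ n) ^+ (2 * m) == 1) = (k %| m)%N.
Proof.
rewrite -exprM -(prim_order_dvd hw) mulnA [(n * 2)%N]mulnC dvdn_pmul2l //.
by rewrite muln_gt0.
Qed.

Lemma exp_modn_w i j : ((w ^+ (2 * k)) ^+ i == (w ^+ (2 * k)) ^+ j) = (i == j %[mod n]).
Proof.
wlog le_ij : i j / (i <= j)%N.
  by move=> H; case/orP: (leq_total i j) => /H // e; rewrite eq_sym e eq_sym.
rewrite [RHS]eq_sym eqn_mod_dvd // -(subnK le_ij) exprD addnK.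
rewrite -[X in X == _]mul1r (inj_eq (mulIf _)) ?expf_neq0 ?w_neq0 //.
rewrite eq_sym -exprM -(prim_order_dvd hw) mulnAC dvdn_pmul2l //.
by rewrite muln_gt0.
Qed.

Lemma expw_nk_neq1 : w ^+ (n * k) != 1.
Proof.
rewrite -(prim_order_dvd hw); apply/negP => /dvdn_leq.
by rewrite -mulnA; nia.
Qed.

Lemma expw_nk : w ^+ (n * k) = -1.
Proof.
have /eqP := prim_expr_order hw; rewrite -mulnA mulnC exprM sqrf_eq1.
by rewrite (negbTE expw_nk_neq1) => /eqP.
Qed.

Lemma expw_kt t : (w ^+ n) ^+ (k * t) = (-1) ^+ t.
Proof. by rewrite -exprM mulnA exprM expw_nk. Qed.

(* [c ^+ j * b ^+ i = (w ^+ n) ^+ (i + j)] says that the antidiagonal matrix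
   acts on the invariant lattice like the second generator. *)
Definition Gnk_like M :=
  (exists a d, [/\ a != 0, d != 0, M = mx2 a 0 0 d &
      forall i j, invlat i j -> a ^+ i * d ^+ j = 1]) \/
  (exists b c, [/\ b != 0, c != 0, M = mx2 0 b c 0 &
      forall i j, invlat i j -> c ^+ j * b ^+ i = (w ^+ n) ^+ (i + j)]).

Lemma mulmx2 (a b c d a' b' c' d' : K) :
  mx2 a b c d *m mx2 a' b' c' d' =
  mx2 (a * a' + b * c') (a * b' + b * d') (c * a' + d * c') (c * b' + d * d').
Proof.
apply/matrixP => i j; rewrite !mxE !big_ord_recl big_ord0 !mxE /= addr0.
by case: (val i == 0%N); case: (val j == 0%N).
Qed.

Lemma invmx_l (M N : 'M[K]_2) : M *m N = 1%:M -> invmx M = N.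
Proof.
move=> MN; have [uM _] := mulmx1_unit MN.
by rewrite -[RHS](mulKmx uM) MN mulmx1.
Qed.

Lemma mx2_1 : mx2 1 0 0 1 = 1%:M :> 'M[K]_2.
Proof. by apply/matrixP => -[[|[|i]] Hi] [[|[|j]] Hj] //; rewrite !mxE. Qed.

Lemma Gnk_likeM M N : Gnk_like M -> Gnk_like N -> Gnk_like (M *m N).
Proof.
case=> [[a [d [a0 d0 -> H]]]|[b [c [b0 c0 -> H]]]];
case=> [[a' [d' [a'0 d'0 -> H']]]|[b' [c' [b'0 c'0 -> H']]]];
rewrite mulmx2 !(mulr0, mul0r) ?addr0 ?add0r.
- left; exists (a * a'), (d * d'); rewrite !mulf_neq0 //; split=> // i j Lij.
  by rewrite !exprMn mulrACA H // H' // mulr1.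
- right; exists (a * b'), (d * c'); rewrite !mulf_neq0 //; split=> // i j Lij.
  by rewrite !exprMn mulrACA H' // [d ^+ j * _]mulrC H // mul1r.
- right; exists (b * d'), (c * a'); rewrite !mulf_neq0 //; split=> // i j Lij.
  by rewrite !exprMn mulrACA H // H' ?mulr1 // invlatC.
- left; exists (b * c'), (c * b'); rewrite !mulf_neq0 //; split=> // i j Lij.
  have Lji : invlat j i by rewrite invlatC.
  rewrite !exprMn mulrACA [b ^+ i * _]mulrC H // H' // addnC -exprD addnn -mul2n.
  by apply/eqP; rewrite expw_eq1; case/andP: Lji.
Qed.

Lemma Gnk_likeV M : Gnk_like M -> Gnk_like (invmx M).
Proof.
case=> [[a [d [a0 d0 -> H]]]|[b [c [b0 c0 -> H]]]].
- left; exists a^-1, d^-1; rewrite !invr_eq0; split=> // [|i j Lij].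
    by apply: invmx_l; rewrite mulmx2 !(mulr0, mul0r, addr0, add0r) !divff // mx2_1.
  by rewrite !exprVn -invfM H // invr1.
- right; exists c^-1, b^-1; rewrite !invr_eq0; split=> // [|i j Lij].
    by apply: invmx_l; rewrite mulmx2 !(mulr0, mul0r, addr0, add0r) !divff // mx2_1.
  rewrite !exprVn -invfM mulrC H 1?invlatC // addnC.
  apply: (mulfI (x := (w ^+ n) ^+ (i + j))); first by rewrite !expf_neq0 ?w_neq0.
  rewrite divff ?expf_neq0 ?w_neq0 // -exprD addnn -mul2n; apply/esym/eqP.
  by rewrite expw_eq1; case/andP: Lij.
Qed.

Lemma inGroup_like M : inGroup (Gnk_gen1 n k w) (Gnk_gen2 n k w) M -> Gnk_like M.
Proof.
elim=> {M} [|||M N _ HM _ HN|M _ HM]; last 2 first.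
- exact: Gnk_likeM.
- exact: Gnk_likeV.
- left; exists (w ^+ (2 * k)), (w ^- (2 * k)).
  rewrite invr_eq0 !expf_neq0 ?w_neq0 //; split=> // i j /andP[ij _].
  rewrite exprVn; apply/eqP; rewrite divf_eq1 ?exp_modn_w //.
  by rewrite !expf_neq0 ?w_neq0.
- right; exists (w ^+ n), (w ^+ n); rewrite !expf_neq0 ?w_neq0 //; split=> // i j _.
  by rewrite -exprD addnC.
- left; exists 1, 1; rewrite mx2_1 oner_neq0; split=> // i j _.
  by rewrite !expr1n mulr1.
Qed.

(** Applying the symmetry twice multiplies a nonzero coefficient by [w^(2n(i+j))], which must be
    1. *)
Lemma invcoef_lat f i j : invcoef f -> f`_i`_j != 0 -> invlat i j.
Proof.
move=> fI fij; have [e1 /(_ fij) ij] := fI i j; have [e2 _] := fI j i.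
rewrite /invlat ij eqxx /= -expw_eq1 mul2n -addnn exprD.
rewrite -(inj_eq (mulIf fij)) mul1r {2}e1 e2 [(j * i)%N]mulnC [(j + i)%N]addnC.
have := sqrr_sign K (i * j); rewrite expr2.
set s := (-1) ^+ _; set z := (w ^+ n) ^+ _ => ss; apply/eqP.
by rewrite -[LHS]mul1r -ss; ring.
Qed.

(** The converse involves every element of the group; its scalars are controlled only on [invlat],
    which contains the support of [f]. *)
Lemma isInvariantP f : isInvariant n k w f <-> invcoef f.
Proof.
split=> [H i j|fI M /inGroup_like HM]; last first.
  apply/polyP => i; apply/polyP => j.
  have [z|fij] := eqVneq f`_i`_j 0.
    have z' : f`_j`_i = 0.
      by apply: contra_eq z; apply: (invcoef_neq0C fI).
    case: HM => [[a [d [_ _ -> _]]]|[b [c [_ _ -> _]]]].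
      by rewrite coef_act_diag z mulr0.
    by rewrite coef_act_anti z' z mulr0.
  have Lij := invcoef_lat fI fij.
  case: HM => [[a [d [_ _ -> h]]]|[b [c [_ _ -> h]]]].
    by rewrite coef_act_diag h ?mul1r.
  by rewrite coef_act_anti [RHS](fI i j).1 -(h _ _ Lij) mulrA.
have g1 := H _ (inG1 _ _); have g2 := H _ (inG2 _ _); split.
  by rewrite -{1}g2 coef_act_anti exprD; ring.
move=> fij; have := congr1 (fun h : skA K => h`_i`_j) g1.
rewrite coef_act_diag exprVn -[X in _ = X]mul1r => /(mulIf fij) /eqP.
by rewrite divf_eq1 ?exp_modn_w => [/eqP|]; rewrite ?expf_neq0 ?w_neq0.
Qed.

Hypothesis k_odd : odd k.

(** The mirror coefficient is nonzero too, hence [j <= i]. On the diagonal, [k] odd gives [k %| i],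
    and the symmetry becomes [c = (-1)^i c] with [-1 = w^(nk) != 1], so [i] is even. *)
Lemma lead_invcoef f i j : invcoef f -> lead f i j ->
  [/\ (j <= i)%N, invlat i j & i = j -> (2 * k %| i)%N].
Proof.
move=> fI [fij fl]; have Lij := invcoef_lat fI fij; split=> //.
  by have := fl _ _ (invcoef_neq0C fI fij); lia.
move=> e; move: fij Lij; rewrite -e => fii /andP[_].
rewrite addnn -mul2n Gauss_dvdr ?coprimen2 // => ki.
rewrite Gauss_dvd ?coprime2n // ki andbT.
have zi : (w ^+ n) ^+ (2 * i) = 1 by apply/eqP; rewrite expw_eq1.
have [+ _] := fI i i; rewrite addnn -mul2n zi mulr1 -{1}[f`_i`_i]mul1r => /(mulIf fii) /esym.
rewrite dvdn2 -signr_odd oddM andbb; case: (odd i) => //.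
by rewrite expr1 -expw_nk => /eqP; rewrite (negbTE expw_nk_neq1).
Qed.

(** * Subduction by leading monomials *)

Hypothesis reach : forall i j,
  (j <= i)%N -> invlat i j -> (i = j -> 2 * k %| i)%N -> lead_reached i j.

(** If the coefficient at [(i, j)] is nonzero, a multiple of some [p] with this leading monomial is
    subtracted; the implication carries membership back from the remainder. *)
Lemma subduction_step f i j : invcoef f -> lex_below f i j.+1 ->
  exists g, [/\ invcoef g, lex_below g i j & inSubalg xs g -> inSubalg xs f].
Proof.
move=> fI fl; have [fij|fij] := eqVneq f`_i`_j 0.
  exists f; split=> // a b fab; have := fl _ _ fab.
  rewrite ltnS [(b <= j)%N]leq_eqVlt.
  have [ea|] //= := eqVneq a i; have [eb|] //= := eqVneq b j.
  by move: fab; rewrite ea eb fij eqxx.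
have [ji Lij dij] := lead_invcoef fI (conj fij fl).
have [p [sp Ip [pij pl]]] := reach ji Lij dij.
set c := f`_i`_j / p`_i`_j.
exists (Defs.addA f (amul (cA (- c)) p)); split.
- exact: invcoef_addZ.
- move=> a b; rewrite coef_addA coef_amul_cA => nz.
  have : (a < i)%N || (a == i) && (b < j.+1)%N.
    have [fab|/fl//] := eqVneq f`_a`_b 0.
    by move: nz; rewrite fab add0r mulf_eq0 negb_or => /andP[_ /pl].
  rewrite ltnS [(b <= j)%N]leq_eqVlt.
  have [ea|] //= := eqVneq a i; have [eb|] //= := eqVneq b j.
  by move: nz; rewrite ea eb /c mulNr divfK // subrr eqxx.
- move=> sg; have -> : f = Defs.addA (Defs.addA f (amul (cA (- c)) p)) (amul (cA c) p).
    apply/polyP => a; apply/polyP => b.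
    by rewrite 2!coef_addA !coef_amul_cA mulNr subrK.
  by apply: sa_add => //; apply: sa_mul => //; apply: sa_const.
Qed.

(** Lexicographic induction on the bound, outer on the [u]-exponent and inner on the
    [v]-exponent. *)
Lemma invcoef_inSubalg f : invcoef f -> inSubalg xs f.
Proof.
move=> fI.
have : lex_below f (size f) 0.
  move=> a b; apply: contraNT; rewrite ltn0 andbF orbF -leqNgt => /(nth_default 0) ->.
  by rewrite coef0.
move: (size f) 0%N => i j; elim: i j f fI => [|i IHi]; elim=> [|j IHj] f fI fl;
  try by have [g [gI gl]] := subduction_step fI fl; apply; apply: IHj.
- have -> : f = cA 0; last exact: sa_const.
  apply/polyP => a; apply/polyP => b; rewrite cA_mono mono0 !coef0.
  by apply/eqP; apply: contraT => /fl; rewrite !ltn0 andbF.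
(* With the second bound at 0, all [u]-exponents are at most [i]; the inner bound restarts at the
   size of the coefficient of [u^i]. *)
- apply: (IHi (size f`_i)) => // a b fab; have := fl _ _ fab.
  rewrite ltn0 andbF orbF ltnS leq_eqVlt orbC => /orP[->//|/eqP e].
  rewrite e eqxx orbC /= ltnNge; apply/orP; left; apply: contra fab => /(nth_default 0).
  by rewrite e => ->.
Qed.

End Invariants.

(** * Hirzebruch-Jung continued fractions *)

Lemma hjval_cons a s : s != [::] -> hjval (a :: s) = a%:~R - (hjval s)^-1.
Proof. by case: s. Qed.

Lemma hjval_gt1 s : s != [::] -> all (fun a => 2 <= a) s -> 1 < hjval s.
Proof.
elim: s => // a s IH _ /andP[a2 s2].
have a2' : 2 <= a%:~R :> rat by rewrite (ler_int _ 2).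
have [->|s0] := eqVneq s [::]; first by rewrite /=; lra.
have h1 := IH s0 s2; rewrite hjval_cons //.
suff : (hjval s)^-1 < 1 by lra.
by rewrite invf_lt1 //; lra.
Qed.

(* [P] is the numerator and [Q] the denominator, up to a common factor;
   the empty expansion stands for [P / 0]. *)
Definition hj_ratio (s : seq int) (P Q : int) :=
  if s is [::] then Q = 0 else P%:~R = hjval s * Q%:~R.

(** From [P/Q = a - 1/x] comes [x = Q/(aQ - P)]; for empty [s], [aQ - P = 0] matches the
    convention. *)
Lemma hj_ratio_step (a : int) s (P Q : int) : all (fun a => 2 <= a) (a :: s) -> 0 < P ->
  hj_ratio (a :: s) P Q -> 0 < Q /\ hj_ratio s Q (a * Q - P).
Proof.
move=> s2 P0 e; have h1 := hjval_gt1 (isT : (a :: s) != [::]) s2; rewrite /hj_ratio in e.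
have Q0 : 0 < Q.
  have : 0 < Q%:~R :> rat; last by rewrite ltr0z.
  by rewrite -(pmulr_rgt0 (x := hjval (a :: s))) -?e ?ltr0z //; lra.
split=> //; case/andP: s2 => _ s2.
have [s0|s0] := eqVneq s [::].
  move: e; rewrite s0 /= => e; apply/eqP; rewrite -(intr_eq0 rat).
  by rewrite rmorphB rmorphM /= e subrr.
have {}h1 := hjval_gt1 s0 s2; move: e; rewrite hjval_cons // => e.
suff : Q%:~R = hjval s * (a * Q - P)%:~R by move: s0; case: (s).
rewrite rmorphB rmorphM /= e; field; apply: lt0r_neq0; lra.
Qed.

(** * Semigroup generation in a plane cone *)

Section Cone.
Variables (S : int -> int -> Prop).
Hypothesis S0 : S 0 0.
Hypothesis SD : forall s t s' t', S s t -> S s' t' -> S (s + s') (t + t').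

Lemma S_muln s t m : S s t -> S (m%:Z * s) (m%:Z * t).
Proof.
move=> h; elim: m => [|m IH]; first by rewrite !mul0r.
by rewrite -addn1 PoszD !mulrDl !mul1r; apply: SD.
Qed.

Lemma S_mulz s t m : 0 <= m -> S s t -> S (m * s) (m * t).
Proof. by case: m => // m _; apply: S_muln. Qed.

Variables (n k : int) (g : seq int) (U V : nat -> int).
Hypothesis g_ge2 : all (fun a => 2 <= a) g.
Hypothesis U_rec : forall j, U j.+2 = g`_j * U j.+1 - U j.
Hypothesis V_rec : forall j, V j.+2 = g`_j * V j.+1 - V j.
(** The cone is where this form is nonnegative. Its values obey the same recurrence, hence are the
    successive remainders of the expansion [g] and reach 0 at index [size g + 1]. *)
Let l j := k * V j - n * U j.
Hypothesis l0 : 0 < l 0.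
Hypothesis l01 : hj_ratio g (l 0) (l 1).

Lemma level_rec j : l j.+2 = g`_j * l j.+1 - l j.
Proof. by rewrite /l U_rec V_rec; ring. Qed.

Lemma level_ratio j : (j <= size g)%N -> 0 < l j /\ hj_ratio (drop j g) (l j) (l j.+1).
Proof.
elim: j => [|j IH] jg; first by rewrite drop0.
have [lj] := IH (ltnW jg); rewrite (drop_nth 0) // level_rec => hj.
apply: hj_ratio_step hj => //; rewrite -(drop_nth 0) //.
by apply/allP => x /mem_drop; move/allP: g_ge2; apply.
Qed.

Lemma level_ge0 j : (j <= (size g).+1)%N -> 0 <= l j.
Proof.
rewrite leq_eqVlt => /orP[/eqP->|/level_ratio[/ltW//]].
by have [_] := level_ratio (leqnn _); rewrite drop_size /= => ->.
Qed.

(** A negative [al] is removed by [U j = g_j U (j+1) - U (j+2)], which makes the new second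
    coefficient [-al] positive. At [j = size g] the second vector has level 0, so the level
    condition forces [al >= 0]. *)
Lemma cone_from j al be : (j <= size g)%N ->
  (forall i, (j <= i <= (size g).+1)%N -> S (U i) (V i)) ->
  0 <= be -> 0 <= al * l j + be * l j.+1 ->
  S (al * U j + be * U j.+1) (al * V j + be * V j.+1).
Proof.
move eqm : (size g - j)%N => m; elim: m j eqm al be => [|m IH] j jm al be jg HS be0 lv;
  (have [al0|al0] := leP 0 al; first by apply: SD; apply: S_mulz => //; apply: HS; lia);
  have [lj hj] := level_ratio jg.
  have ej : j = size g by lia.
  by move: hj lv; rewrite {1}ej drop_size /= => ->; nia.
have jlt : (j < size g)%N by lia.
have -> : al * U j + be * U j.+1 = (be + al * g`_j) * U j.+1 + (- al) * U j.+2.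
  by rewrite U_rec; ring.
have -> : al * V j + be * V j.+1 = (be + al * g`_j) * V j.+1 + (- al) * V j.+2.
  by rewrite V_rec; ring.
apply: IH => //; first by lia.
- by move=> i hi; apply: HS; lia.
- by lia.
- by rewrite level_rec; apply: le_trans lv _; rewrite le_eqVlt; apply/orP; left; apply/eqP; ring.
Qed.

(* Only the even multiples of the first vector are needed: an odd one is
   absorbed by the extra element [(U 0 + U 1, V 0 + V 1)]. *)
Lemma cone_even al be :
  (forall i, (1 <= i <= (size g).+1)%N -> S (U i) (V i)) ->
  S (U 0 + U 1) (V 0 + V 1) -> S (2 * U 0) (2 * V 0) ->
  0 <= be -> 0 <= al * l 0 + be * l 1 -> (be = 0 -> (2 %| al)%Z) ->
  S (al * U 0 + be * U 1) (al * V 0 + be * V 1).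
Proof.
move=> HS S01 S00 be0 lv ev; have [al0|al0] := leP 0 al; last first.
  have [e|g0] := posnP (size g).
    have := l01; move: lv; rewrite /hj_ratio (size0nil e) => + l1.
    by rewrite l1; move: l0; nia.
  (* Once [U 0] is eliminated, [cone_from] at index 1 uses only vectors assumed to lie in [S]. *)
  have -> : al * U 0 + be * U 1 = (be + al * g`_0) * U 1 + (- al) * U 2.
    by rewrite U_rec; ring.
  have -> : al * V 0 + be * V 1 = (be + al * g`_0) * V 1 + (- al) * V 2.
    by rewrite V_rec; ring.
  apply: cone_from => //; first by lia.
  by rewrite level_rec; apply: le_trans lv _; rewrite le_eqVlt; apply/orP; left; apply/eqP; ring.
have S1 : S (U 1) (V 1) by apply: HS.
have [m [al_m m0]] : exists m, (al = 2 * m \/ al = 2 * m + 1) /\ 0 <= m.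
  by exists (al %/ 2)%Z; lia.
case: al_m => e.
  have -> : al * U 0 + be * U 1 = m * (2 * U 0) + be * U 1 by rewrite e; ring.
  have -> : al * V 0 + be * V 1 = m * (2 * V 0) + be * V 1 by rewrite e; ring.
  by apply: SD; apply: S_mulz.
(* Here [al] is odd, so [be] is nonzero and one copy of [U 1] can be paired with [U 0]. *)
have be1 : 1 <= be by lia.
have -> : al * U 0 + be * U 1 = m * (2 * U 0) + (U 0 + U 1) + (be - 1) * U 1.
  by rewrite e; ring.
have -> : al * V 0 + be * V 1 = m * (2 * V 0) + (V 0 + V 1) + (be - 1) * V 1.
  by rewrite e; ring.
by apply: SD; [apply: SD => // |]; apply: S_mulz => //; lia.
Qed.

End Cone.

(** * The generators *)

(** [N + r] and [r] are the exponents of the leading monomial of [x_i]; the hypotheses make absolute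
    values and halving exact. *)
Lemma xgen_degree (n k : nat) gamma i (N := (n * `|sseq gamma i|)%N)
    (r := `|(twice_r n k gamma i %/ 2)%Z|%N) :
  0 < sseq gamma i -> 0 <= twice_r n k gamma i -> (2 %| twice_r n k gamma i)%Z ->
  n%:Z * sseq gamma i = N%:Z /\ k%:Z * tseq gamma i = (N + r + r)%N%:Z.
Proof.
move=> s_gt0 r_ge0 r_even.
have e1 : n%:Z * sseq gamma i = N%:Z by rewrite /N PoszM gez0_abs // ltW.
split=> //; have : 2 * r%:Z = twice_r n k gamma i.
  by rewrite /r gez0_abs ?divz_ge0 // mulrC divzK.
by rewrite /twice_r e1 !PoszD; lia.
Qed.

Section Generators.
Variables (K : fieldType) (n k : nat) (w : K).

Lemma lead_xlast : lead (xlast k : skA K) (2 * k) (2 * k).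
Proof.
rewrite /xlast; have [e ->] := apow_uv K (2 * k).
split; first by rewrite coef_mono !eqxx signr_eq0.
move=> a b; rewrite coef_mono.
have [/andP[/eqP-> /eqP->]|_] := boolP ((a == _) && _); last by rewrite eqxx.
by rewrite eqxx ltnSn orbT.
Qed.

(** [(-1)^e] comes from [(uv)^r], and the exponent [N r] from moving [v^N] past [u^r]. *)
Lemma xgenE gamma i :
  let N := (n * `|sseq gamma i|)%N in
  let r := `|(twice_r n k gamma i %/ 2)%Z|%N in
  exists e : bool, xgen n k gamma i =
    Defs.addA (mono ((-1) ^+ e) (N + r) r)
              (mono ((-1) ^+ (r + N + N * r) * (-1) ^+ e : K) r (N + r)).
Proof.
move=> N r; have [e E] := apow_uv K r; exists e.
rewrite /xgen -/N -/r E uA_mono vA_mono apow_u apow_v cA_mono amul_mono amulDl !amul_mono.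
rewrite !expr1n !mulr1 !mul0n !expr0 ?addn0 !mul1r !add0n.
by rewrite -exprD [(N * r + _)%N]addnC.
Qed.

Lemma lead_xgen gamma i (N := (n * `|sseq gamma i|)%N)
    (r := `|(twice_r n k gamma i %/ 2)%Z|%N) :
  (0 < n)%N -> 0 < sseq gamma i -> lead (xgen n k gamma i : skA K) (N + r) r.
Proof.
move=> n_gt0 s_gt0; have [e ->] := xgenE gamma i; rewrite -/N -/r.
have N0 : (0 < N)%N by rewrite muln_gt0 n_gt0 /= absz_gt0 gt_eqF.
split.
  rewrite coef_addA !coef_mono !eqxx; have -> : (N + r == r)%N = false by lia.
  by rewrite addr0 signr_eq0.
move=> a b; rewrite coef_addA !coef_mono.
have [/andP[/eqP-> /eqP->]|_] := boolP ((a == _) && _); first by rewrite eqxx ltnSn orbT.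
have [/andP[/eqP-> /eqP->] _|_] := boolP ((a == _) && _); last by rewrite addr0 eqxx.
by rewrite -[X in (X < _)%N]add0n ltn_add2r N0.
Qed.

Hypotheses (n_gt0 : (0 < n)%N) (k_gt0 : (0 < k)%N).
Hypothesis hw : (2 * n * k).-primitive_root w.

Lemma invcoef_mono (e : K) m : (-1) ^+ m * (w ^+ n) ^+ (m + m) = 1 :> K ->
  invcoef n w (mono e m m).
Proof.
move=> h i j; rewrite !coef_mono [in RHS]andbC.
have [/andP[/eqP-> /eqP->]|] := boolP (_ && _); last by rewrite mulr0n mulr0 eqxx.
by split=> //; rewrite -signr_odd oddM andbb signr_odd h mul1r.
Qed.

Lemma invcoef_xlast : invcoef n w (xlast k).
Proof.
rewrite /xlast; have [e ->] := apow_uv K (2 * k); apply: invcoef_mono.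
have -> : (2 * k + 2 * k = k * 4)%N by lia.
by rewrite (expw_kt n_gt0 k_gt0 hw) -signr_odd -[X in _ * X]signr_odd oddM mulr1.
Qed.

(** The symmetry factor squares to 1 since [k] divides [a + b], so the relation between [e] and [e']
    holds in both directions. *)
Lemma invcoef_sum_mono (e e' : K) a b :
  a = b %[mod n] -> (k %| a + b)%N -> e' = (-1) ^+ (a * b) * (w ^+ n) ^+ (a + b) * e ->
  invcoef n w (Defs.addA (mono e a b) (mono e' b a)).
Proof.
move=> ab kab he i j.
have zz : ((-1) ^+ (a * b) * (w ^+ n) ^+ (a + b)) * ((-1) ^+ (a * b) * (w ^+ n) ^+ (a + b)) = 1.
  rewrite mulrACA -expr2 sqrr_sign mul1r -exprD addnn -mul2n.
  by apply/eqP; rewrite (expw_eq1 n_gt0 hw).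
have h1 : (-1) ^+ (i * j) * (w ^+ n) ^+ (i + j) * (e' *+ ((i == a) && (j == b))) =
    e *+ ((i == a) && (j == b)).
  have [/andP[/eqP-> /eqP->]|_] := boolP (_ && _); last by rewrite !mulr0n mulr0.
  by rewrite !mulr1n he mulrA zz mul1r.
have h2 : (-1) ^+ (i * j) * (w ^+ n) ^+ (i + j) * (e *+ ((i == b) && (j == a))) =
    e' *+ ((i == b) && (j == a)).
  have [/andP[/eqP-> /eqP->]|_] := boolP (_ && _); last by rewrite !mulr0n mulr0.
  by rewrite !mulr1n he mulnC addnC.
rewrite !coef_addA !coef_mono; split.
  by rewrite mulrDr ![(j == _) && _]andbC h1 h2 addrC.
move=> H; have : ((i == a) && (j == b)) || ((i == b) && (j == a)).
  by move: H; case: (_ && _) => //; case: (_ && _); rewrite // addr0 eqxx.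
by case/orP=> /andP[/eqP-> /eqP->].
Qed.

Variable gamma : seq int.

Section Exponents.
Variable i : nat.
Hypotheses (s_gt0 : 0 < sseq gamma i) (r_ge0 : 0 <= twice_r n k gamma i).
Hypothesis r_even : (2 %| twice_r n k gamma i)%Z.
Let N := (n * `|sseq gamma i|)%N.
Let r := `|(twice_r n k gamma i %/ 2)%Z|%N.

(** From [N + 2r = kt] with [k] odd, [t] and [N] have the same parity, so [w^(nkt) = (-1)^N]; the
    signs agree because [r^2] and [r] have the same parity. *)
Lemma invcoef_xgen : odd k -> invcoef n w (xgen n k gamma i).
Proof.
move=> k_odd; have [e ->] := xgenE gamma i; rewrite -/N -/r.
have [eN ekt] := xgen_degree s_gt0 r_ge0 r_even.
have [t et] : exists t, (N + r + r = k * t)%N.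
  exists `|tseq gamma i|%N; have : 0 <= tseq gamma i by nia.
  by move=> t0; nia.
apply: invcoef_sum_mono.
- by rewrite -modnDml /N modnMr.
- by rewrite et dvdn_mulr.
have -> : (w ^+ n) ^+ (N + r + r) = (-1) ^+ N.
  rewrite et (expw_kt n_gt0 k_gt0 hw) -signr_odd -[in RHS]signr_odd; congr (_ ^+ _).
  by have := congr1 odd et; rewrite !oddD oddM k_odd addbK /= => ->.
rewrite -[X in _ = X * _]exprD; congr (_ * _).
rewrite -signr_odd -[in RHS]signr_odd; congr (_ ^+ _).
by move: (N) (r) => M q; rewrite !oddD !oddM !oddD; case: (odd M); case: (odd q).
Qed.

End Exponents.

End Generators.

(** * The exponents *)

Section Sequences.
Variables (a2 : int) (g : seq int).
Let gamma := [:: 2, a2 & g].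

(* [(0, 2)] is the difference of the first two exponent vectors; prepending it
   turns the modified coefficient [beta 3] back into [gamma_3]. *)
Definition expU j := if j is j'.+1 then sseq gamma j'.+2 else 0.
Definition expV j := if j is j'.+1 then tseq gamma j'.+2 else 2.

(** At [j = 0] the extra 1 in [beta 3] leaves the correction [s_2 - s_1 = 0], and [t_2 - t_1 = -2]
    in [expV_rec]: these are [- expU 0] and [- expV 0]. *)
Lemma expU_rec j : expU j.+2 = g`_j * expU j.+1 - expU j.
Proof.
by case: j => [|j] //=; rewrite /sseq /rec2 /= /beta /=; ring.
Qed.

Lemma expV_rec j : expV j.+2 = g`_j * expV j.+1 - expV j.
Proof.
by case: j => [|j] //=; rewrite /tseq /rec2 /= /beta /=; ring.
Qed.

Lemma expU_incr j : all (fun a => 2 <= a) g -> (j <= size g)%N -> 0 <= expU j < expU j.+1.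
Proof.
move=> g_ge2; elim: j => [|j IH] jg //.
have := IH (ltnW jg); have /allP/(_ g`_j) := g_ge2; rewrite mem_nth // => /(_ isT).
by rewrite expU_rec; nia.
Qed.

Lemma expUV_parity j : (2 %| expV j - expU j)%Z.
Proof.
suff /andP[] : (2 %| expV j - expU j)%Z && (2 %| expV j.+1 - expU j.+1)%Z by [].
elim: j => [|j /andP[h1 h2]].
  by rewrite /= /sseq /tseq /rec2 /=; lia.
rewrite h2 expU_rec expV_rec.
have -> : g`_j * expV j.+1 - expV j - (g`_j * expU j.+1 - expU j) =
   g`_j * (expV j.+1 - expU j.+1) - (expV j - expU j) by ring.
by rewrite rpredB // dvdz_mull.
Qed.

Lemma level_parity (n k : nat) j : odd n -> odd k ->
  (2 %| k%:Z * expV j - n%:Z * expU j)%Z.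
Proof.
move=> n_odd k_odd; have /dvdzP[m em] := expUV_parity j.
have -> : expV j = m * 2 + expU j by rewrite -em subrK.
have -> : k%:Z = k./2%:Z * 2 + 1 by have := odd_double_half k; rewrite k_odd; lia.
have -> : n%:Z = n./2%:Z * 2 + 1 by have := odd_double_half n; rewrite n_odd; lia.
apply/dvdzP; exists (k./2%:Z * (m * 2 + expU j) + m - n./2%:Z * expU j); ring.
Qed.

End Sequences.

(** [2n/(n+k)] lies strictly between 1 and 2, which forces the first entry 2 and the existence of a
    second. Two steps take the pair [2n, n+k] to [n+k, 2k] and then to [2k, k(2 a2 - 1) - n], the
    levels of the first two vectors of the cone. *)
Lemma is_HJ_shape (n k : nat) gamma : (0 < k < n)%N ->
  is_HJ gamma ((2 * n)%:R / (n + k)%:R) -> exists a2 g,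
  [/\ gamma = [:: 2, a2 & g], all (fun a => 2 <= a) g &
      hj_ratio g (k%:Z * 2) (k%:Z * (2 * a2 - 1) - n%:Z)].
Proof.
move=> /andP[k0 kn]; case: gamma => [|a1 gam] [] // _; rewrite [head _ _]/= [behead _]/=.
move=> a1_ge1 gam_ge2 val_gam.
have nk0 : 0 < (n + k)%:R :> rat by rewrite ltr0n; lia.
have kR : 0 < k%:R :> rat by rewrite ltr0n.
have knR : k%:R < n%:R :> rat by rewrite ltr_nat.
have x_lt2 : (2 * n)%:R / (n + k)%:R < 2%:R :> rat.
  by rewrite ltr_pdivrMr // natrM natrD; lra.
have x_gt1 : 1 < (2 * n)%:R / (n + k)%:R :> rat.
  by rewrite ltr_pdivlMr // natrM natrD; lra.
move: x_lt2 x_gt1; rewrite -val_gam => x_lt2 x_gt1.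
have gam0 : gam != [::].
  apply/eqP => gam0; move: x_lt2 x_gt1; rewrite gam0 /= (ltr_int _ _ 2) (ltr_int _ 1); lia.
have h1 := hjval_gt1 gam0 gam_ge2.
have hV : 0 < (hjval gam)^-1 < 1.
  by rewrite invr_gt0 invf_lt1 ?h1 ?andbT; lra.
have a1E : a1 = 2.
  move: x_lt2 x_gt1; rewrite hjval_cons // => x_lt2 x_gt1.
  have : 1 < a1%:~R :> rat by lra.
  have : a1%:~R < 3%:R :> rat by lra.
  by rewrite (ltr_int _ _ 3) (ltr_int _ 1); lia.
move: val_gam; rewrite a1E => val_gam.
have [_ ] : 0 < (n + k)%:Z /\ hj_ratio gam (n + k)%:Z (2 * (n + k)%:Z - (2 * n)%:Z).
  apply: (hj_ratio_step (P := (2 * n)%:Z)); first by rewrite /= gam_ge2.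
    by lia.
  by rewrite /hj_ratio val_gam divfK // gt_eqF.
case: gam gam0 gam_ge2 {h1 hV val_gam x_lt2 x_gt1} => // a2 g _ gg /hj_ratio_step [] //.
  by lia.
move=> _ hg; case/andP: gg => _ g2; exists a2, g; split=> //.
move: hg; congr hj_ratio; rewrite PoszD !PoszM; ring.
Qed.

Lemma invlat_coords (n k i j : nat) : odd n -> odd k -> (j <= i)%N -> invlat n k i j ->
  exists s t, [/\ (i = j + s * n)%N, (i + j = t * k)%N & odd s = odd t].
Proof.
move=> n_odd k_odd ji /andP[ij /dvdnP[t et]].
move: ij; rewrite eqn_mod_dvd // => /dvdnP[s es].
have {}es : (i = j + s * n)%N by rewrite -es subnKC.
exists s, t; split=> //.
have := congr1 odd et; rewrite es !oddD !oddM n_odd k_odd !andbT => <-.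
by case: (odd j); case: (odd s).
Qed.

(** * Reaching the admissible leading monomials *)

Section Reach.
Variables (n k : nat).
Hypotheses (k_gt0 : (0 < k)%N) (k_lt_n : (k < n)%N).
Hypotheses (n_odd : odd n) (k_odd : odd k).
Variables (a2 : int) (g : seq int).
Let gamma := [:: 2, a2 & g].
Hypothesis g_ge2 : all (fun a => 2 <= a) g.
Hypothesis hg : hj_ratio g (k%:Z * 2) (k%:Z * (2 * a2 - 1) - n%:Z).

Let n_gt0 : (0 < n)%N. Proof. exact: leq_ltn_trans k_lt_n. Qed.

Let U := expU a2 g.
Let V := expV a2 g.
Let l j := k%:Z * V j - n%:Z * U j.

Let l0 : 0 < l 0. Proof. by rewrite /l /U /V /=; lia. Qed.

Let l01 : hj_ratio g (l 0) (l 1).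
Proof.
rewrite /l /U /V /= /tseq /sseq /rec2 /beta /= !mulr0 subr0 mulr1.
exact: hg.
Qed.

Lemma exponents_ok i : (1 <= i <= (size g).+2)%N ->
  [/\ 0 < sseq gamma i, 0 <= twice_r n k gamma i & (2 %| twice_r n k gamma i)%Z].
Proof.
case: i => [|[|j]] // /andP[_ ij].
  (* The vector of [x_1] is the sum of those at indices 0 and 1; for [i >= 2], that of [x_i] is at
     index [i - 1]. *)
  have e : twice_r n k gamma 1 = l 0 + l 1.
    by rewrite /l /U /V /twice_r /= /tseq /sseq /rec2 /beta /=; ring.
  rewrite e; split=> //; last by rewrite rpredD // level_parity.
  apply: addr_ge0; first exact: ltW.
  exact: (level_ge0 g_ge2 (expU_rec a2 g) (expV_rec a2 g) l0 l01).
have e : twice_r n k gamma j.+2 = l j.+1 by [].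
rewrite e level_parity //; split=> //.
  by have /andP[] := expU_incr a2 g_ge2 (ij : (j <= size g)%N); apply: le_lt_trans.
exact: (level_ge0 g_ge2 (expU_rec a2 g) (expV_rec a2 g) l0 l01).
Qed.

Variables (K : fieldType) (w : K).
Hypothesis hw : (2 * n * k).-primitive_root w.

Variable xs : seq (skA K).
Hypothesis xs_gen : forall i, (1 <= i <= (size g).+2)%N -> xgen n k gamma i \in xs.
Hypothesis xs_last : xlast k \in xs.

Definition reached_at (s t : int) := exists i j : nat,
  [/\ lead_reached n w xs i j, i%:Z - j%:Z = n%:Z * s & i%:Z + j%:Z = k%:Z * t].

Lemma reached_gen i : (1 <= i <= (size g).+2)%N ->
  reached_at (sseq gamma i) (tseq gamma i).
Proof.
move=> hi; have [s0 r0 r2] := exponents_ok hi.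
have [eN ek] := xgen_degree s0 r0 r2.
exists (n * `|sseq gamma i| + `|(twice_r n k gamma i %/ 2)%Z|)%N, `|(twice_r n k gamma i %/ 2)%Z|%N.
split; last 2 first.
- by rewrite eN PoszD addrK.
- by rewrite ek -PoszD.
exists (xgen n k gamma i); split; first exact/sa_gen/xs_gen.
  exact: invcoef_xgen.
exact: lead_xgen.
Qed.

Lemma reach_all i j : (j <= i)%N -> invlat n k i j -> (i = j -> 2 * k %| i)%N ->
  lead_reached n w xs i j.
Proof.
move=> ji Lij dij; have [s [t [es et par]]] := invlat_coords n_odd k_odd ji Lij.
(* [al] and [s] are the coordinates of [(s, t)] in the basis [(0, 2)], [(1, 2 a2 - 1)]; equal parity
   of [s] and [t] makes [al] an integer. *)
have [al ea] : exists al : int, t%:Z = s%:Z * (2 * a2 - 1) + al * 2.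
  exists (((t%:Z + s%:Z)%R %/ 2)%Z - s%:Z * a2).
  have /divzK : (2 %| (t%:Z + s%:Z)%R)%Z by move: par; clear; lia.
  by clear; lia.
suff [i' [j' [h e1 e2]]] : reached_at s t.
  by have [-> ->] : i = i' /\ j = j' by move: es et e1 e2; clear; lia.
have -> : (s : int) = al * U 0 + s%:Z * U 1.
  by rewrite /U /= /sseq /rec2 /=; ring.
have -> : (t : int) = al * V 0 + s%:Z * V 1.
  by rewrite ea /V /= /tseq /rec2 /beta /=; ring.
apply: (cone_even _ _ g_ge2 (expU_rec a2 g) (expV_rec a2 g) l0 l01) => //.
- by exists 0%N, 0%N; rewrite !mulr0; split=> //; apply: lead_reached0.
- move=> s1 t1 s2 t2 [i1 [j1 [h1 e1 e1']]] [i2 [j2 [h2 e2 e2']]].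
  exists (i1 + i2)%N, (j1 + j2)%N; rewrite !PoszD !mulrDr -e1 -e1' -e2 -e2'.
  by split; [apply: lead_reachedD | ring | ring].
- by case=> [//|m] hm; apply: reached_gen.
- have -> : U 0 + U 1 = sseq gamma 1 by [].
  have -> : V 0 + V 1 = tseq gamma 1.
    by rewrite /V /= /tseq /rec2 /beta /=; ring.
  by apply: reached_gen.
(* [x_d] has exponents [(2k, 2k)], that is [(s, t) = (0, 4)], twice [(0, 2)]. *)
- exists (2 * k)%N, (2 * k)%N; rewrite subrr /U /V /= !mulr0; split=> //; last by lia.
  exists (xlast k); split; [exact: sa_gen | exact: invcoef_xlast | exact: lead_xlast].
- have -> : al * (k%:Z * V 0 - n%:Z * U 0) + s%:Z * (k%:Z * V 1 - n%:Z * U 1) =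
            k%:Z * t%:Z - n%:Z * s%:Z.
    by rewrite ea /U /V /= /sseq /tseq /rec2 /beta /=; ring.
  (* [kt - ns = (i + j) - (i - j) = 2j]. *)
  by move: et; rewrite es; clear; lia.
(* For [s = 0] the hypothesis gives [i = j = 2km], so [kt = 4km] and [al = 2m]. *)
- move=> s0; have {}s0 : s = 0%N by case: s0.
  have /dij/dvdnP[m em] : i = j by rewrite es s0 addn0.
  have t4 : t = (4 * m)%N.
    by apply/eqP; rewrite -(eqn_pmul2r k_gt0) -et; move: em es; rewrite s0; clear; lia.
  by apply/dvdzP; exists m%:Z; move: ea; rewrite s0 t4; clear; lia.
Qed.

End Reach.

Theorem mainTheorem19 (K : closedFieldType) (Kchar0 : [pchar K] =i pred0)
    (n k : nat) (hk : (1 <= k)%N) (hkn : (k < n)%N)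
    (hn_odd : odd n) (hk_odd : odd k) (hcop : coprime n k)
    (w : K) (hw : (2 * n * k).-primitive_root w)
    (gamma : seq int)
    (hgamma : is_HJ gamma ((2 * n)%:R / (n + k)%:R)) :
  let d := (size gamma).+1 in
  let xs := [seq xgen (K:=K) n k gamma i | i <- iota 1 (d - 1)] ++ [:: xlast k] in
  (* well-definedness of the exponents n s_i and r_i as natural numbers *)
  (forall i, (1 <= i <= d - 1)%N ->
     0 <= sseq gamma i /\ 0 <= twice_r n k gamma i /\ (2 %| twice_r n k gamma i)%Z) /\
  (* the x_i lie in A^G ... *)
  (forall x, x \in xs -> isInvariant n k w x) /\
  (* ... and generate it as a k-algebra *)
  (forall f : skA K, isInvariant n k w f -> inSubalg xs f).
Proof.
have n_gt0 : (0 < n)%N by exact: leq_ltn_trans hkn.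
have k_bounds : (0 < k < n)%N by rewrite hk hkn.
have [a2 [g [-> g_ge2 hg]]] := is_HJ_shape k_bounds hgamma.
move=> d xs; rewrite [(d - 1)%N]subn1 [d.-1]/=.
have ok := exponents_ok hk hkn hn_odd hk_odd g_ge2 hg.
split=> [i /ok[s0 r0 r2]|]; first by rewrite ltW.
split=> [x|f /(isInvariantP n_gt0 hk hw) fI].
  rewrite mem_cat mem_seq1 => /orP[/mapP[i]|/eqP->];
    last exact/(isInvariantP n_gt0 hk hw)/invcoef_xlast.
  rewrite mem_iota add1n ltnS => /ok[s0 r0 r2] ->.
  exact/(isInvariantP n_gt0 hk hw)/invcoef_xgen.
apply: (invcoef_inSubalg n_gt0 hk hw hk_odd) fI.
apply: (reach_all hk hkn hn_odd hk_odd g_ge2 hg hw) => [i hi|]; last first.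
  by rewrite mem_cat mem_head orbT.
by rewrite mem_cat map_f // mem_iota add1n ltnS.
Qed.
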